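(* Let $A\in\mathbb{R}^{n\times n}$ be symmetric positive definite with smallest eigenvalue $\mu>0$ and largest eigenvalue $L\le 1$, let $\bm{b},\bm{x}_0\in\mathbb{R}^n$, and let $(\bm{x}_k)$, $(\bm{r}_k)$, $(\alpha_k)$ be generated by the adaptive gradient descent iteration described in the context, where the rate estimate is $\rho_k=\rho_k^{l}$, the geometric mean of the ratios of successive residual norms with window $l$ (either $l\ge 1$ is a fixed integer, or $l=k$ at every iteration $k$). Then for every $k\ge 1$ such that $\bm{r}_0,\dots,\bm{r}_{k-1}$ are nonzero, $$0\le \frac{\|\bm{r}_k\|}{\|\bm{r}_{k-1}\|}\le 1-\mu .$$
   Context: $\|\cdot\|$ is the Euclidean norm. The objective is $f(\bm{x})=\frac12\bm{x}^TA\bm{x}-\bm{b}^T\bm{x}$, so $-\nabla f(\bm{x})=\bm{b}-A\bm{x}$. Adaptive gradient descent: set $\bm{r}_0=\bm{b}-A\bm{x}_0$ and $\alpha_1=1$. For $k=1,2,\dots$: $$\bm{x}_k=\bm{x}_{k-1}+\alpha_k\bm{r}_{k-1},\qquad \bm{r}_k=\bm{b}-A\bm{x}_k,\qquad \alpha_{k+1}=1+\rho_k,$$ where $\rho_k$ is a rate estimate. Here $\rho_k=\rho_k^{l}$ with $$\rho_k^{l}=\begin{cases}\left(\dfrac{\|\bm{r}_k\|}{\|\bm{r}_0\|}\right)^{1/k}, & k<l,\\[2mm] \left(\displaystyle\prod_{i=k-l+1}^{k}\frac{\|\bm{r}_i\|}{\|\bm{r}_{i-1}\|}\right)^{1/l},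 & k\ge l.\end{cases}$$ For $l=1$ this is $\rho_k^1=\|\bm{r}_k\|/\|\bm{r}_{k-1}\|$. The choice $l=k$ (full history) means $\rho_k=(\|\bm{r}_k\|/\|\bm{r}_0\|)^{1/k}$ for every $k$. *)

(* Defs.v *)
From mathcomp Require Export all_boot all_order all_algebra.
From mathcomp Require Export all_classical all_reals all_analysis.

Set Implicit Arguments.
Unset Strict Implicit.
Unset Printing Implicit Defensive.

Import Order.TTheory GRing.Theory Num.Theory.
Local Open Scope ring_scope.

(* The library norm `|v| on matrices is the sup norm, hence this definition. *)
Definition enorm (R : realType) (n : nat) (v : 'cV[R]_n) : R :=
  Num.sqrt (\sum_(i < n) v i 0 ^+ 2).

Definition spd (R : realType) (n : nat) (A : 'M[R]_n) : Prop :=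
  A^T = A /\ forall v : 'cV[R]_n, v != 0 -> 0 < (v^T *m A *m v) 0 0.

Definition smallest_eigenvalue (R : realType) (n : nat) (A : 'M[R]_n) (mu : R)
  : Prop :=
  eigenvalue A mu /\ forall a : R, eigenvalue A a -> mu <= a.

Definition largest_eigenvalue (R : realType) (n : nat) (A : 'M[R]_n) (L : R)
  : Prop :=
  eigenvalue A L /\ forall a : R, eigenvalue A a -> a <= L.

(* rho_k^l for k, l >= 1; the m-th root is the real power m%:R^-1, which maps
   0 to 0. *)
Definition window_rate (R : realType) (n : nat) (r : nat -> 'cV[R]_n)
    (l k : nat) : R :=
  if (k < l)%N then (enorm (r k) / enorm (r 0%N)) `^ (k%:R^-1)
  else (\prod_((k - l).+1 <= i < k.+1) (enorm (r i) / enorm (r i.-1)))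
         `^ (l%:R^-1).

(* Residuals and iterates are indexed from 0, step sizes and rates from 1:
   alpha 0 and rho 0 are unconstrained and never used. *)
Definition adaptive_gd (R : realType) (n : nat) (A : 'M[R]_n)
    (b x0 : 'cV[R]_n) (rho : nat -> R)
    (x r : nat -> 'cV[R]_n) (alpha : nat -> R) : Prop :=
  [/\ x 0%N = x0,
      forall k : nat, r k = b - A *m x k,
      alpha 1%N = 1,
      forall k : nat, (0 < k)%N -> x k = x k.-1 + alpha k *: r k.-1
    & forall k : nat, (0 < k)%N -> alpha k.+1 = 1 + rho k].

Lemma enorm_eq0 (R : realType) (n : nat) (v : 'cV[R]_n) :
  (enorm v == 0) = (v == 0).
Proof.
have s0 : 0 <= \sum_(i < n) v i 0 ^+ 2 by apply: sumr_ge0 => i _; exact: sqr_ge0.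
rewrite /enorm sqrtr_eq0 le_eqVlt ltNge s0 orbF; apply/eqP/eqP => [h|->].
  apply/matrixP => i j; rewrite ord1 mxE; apply/eqP; rewrite -sqrf_eq0.
  by apply/eqP; apply: (psumr_eq0P _ h) => // k _; exact: sqr_ge0.
by apply: big1 => i _; rewrite mxE expr0n.
Qed.

(* With l = k the product telescopes to the full-history rate. *)
Lemma window_rate_full (R : realType) (n : nat) (r : nat -> 'cV[R]_n)
    (k : nat) : (0 < k)%N -> (forall i : nat, (i < k)%N -> r i != 0) ->
  window_rate r k k = (enorm (r k) / enorm (r 0%N)) `^ (k%:R^-1).
Proof.
move=> k0 nz; rewrite /window_rate ltnn subnn big_add1 /=; congr (_ `^ _).
have e i : (i < k)%N -> enorm (r i) != 0 by move=> ik; rewrite enorm_eq0 nz.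
elim: k k0 e {nz} => // k IH _ e; rewrite big_nat_recr //=.
case: k IH e => [|k] IH e; first by rewrite big_geq // mul1r.
rewrite IH //; last by move=> i ik; apply: e; exact: ltnW.
by rewrite mulrC mulrA divfK // e.
Qed.

(* Main.v *)
From mathcomp Require Import complex lra.
Require Import Defs.

Set Implicit Arguments.
Unset Strict Implicit.
Unset Printing Implicit Defensive.

Import Order.TTheory GRing.Theory Num.Theory.
Local Open Scope ring_scope.

(* The residuals satisfy [r_k = (1 - alpha_k A) r_{k-1}], and the spectral norm
   of the symmetric matrix [1 - alpha A] is at most [1 - mu] whenever
   [1 <= alpha <= 2 - mu], since its eigenvalues are [1 - alpha lambda] with
   [mu <= lambda <= 1].  So if all earlier ratios lie in [[0, 1 - mu]], their
   geometric mean [alpha_k - 1] does too, hence so does the next ratio. *)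

Lemma dotmx_sum (C : numClosedFieldType) n (u : 'rV[C]_n) :
  dotmx u u = \sum_i `|u 0 i| ^+ 2.
Proof. by rewrite dotmxE mxE; apply: eq_bigr => i _; rewrite !mxE normCK. Qed.

Lemma dotmx_mul_unitary (C : numClosedFieldType) n (P : 'M[C]_n)
    (u : 'rV[C]_n) :
  P \is unitarymx -> dotmx (u *m P) (u *m P) = dotmx u u.
Proof.
by move=> /mulmxtVK PV; rewrite !dotmxE trmx_mul map_mxM mulmxA PV.
Qed.

(** Row [i] of the diagonalizing matrix [P] is a left eigenvector; it is nonzero because [P] is
    invertible. *)
Lemma eigenvalue_spectral_diag (C : numClosedFieldType) n (M : 'M[C]_n) i :
  M \is normalmx -> eigenvalue M (spectral_diag M 0 i).
Proof.
move=> /orthomx_spectralP Mspec; set P := spectralmx M.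
have Pu : P \in unitmx := spectral_unit M.
apply/eigenvalueP; exists (row i P).
  rewrite {1}Mspec -/P -row_mul !mulmxA mulmxV // mul1mx.
  by rewrite row_mul row_diag_mx -scalemxAl -rowE.
apply: contraTneq Pu => P0; rewrite -row_free_unit; apply/negP => Pf.
have /(row_free_inj Pf) : delta_mx 0 i *m P = (0 : 'rV_n) *m P.
  by rewrite -rowE P0 mul0mx.
by move=> /rowP/(_ i)/eqP; rewrite !mxE !eqxx oner_eq0.
Qed.

(** In a unitary eigenbasis [M] only scales the coordinates, and unitary maps preserve [dotmx u u],
    so the bound can be checked coordinate by coordinate. *)
Lemma normalmx_dotmx_le (C : numClosedFieldType) n (M : 'M[C]_n) (c : C)
    (u : 'rV[C]_n) :
  M \is normalmx -> (forall i, `|spectral_diag M 0 i| <= c) ->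
  dotmx (u *m M) (u *m M) <= c ^+ 2 * dotmx u u.
Proof.
move=> Mn cP; have /orthomx_spectralP Mspec := Mn.
have Pu := spectral_unitarymx M; set P := spectralmx M in Pu Mspec.
rewrite {1 2}Mspec -/P invmx_unitary // !mulmxA dotmx_mul_unitary //.
rewrite -(@dotmx_mul_unitary _ _ (P ^t Num.conj)%sesqui u) ?trmxC_unitary //.
rewrite !dotmx_sum mulr_sumr; apply: ler_sum => i _.
rewrite mul_mx_diag mxE normrM exprMn mulrC.
by rewrite ler_wpM2r ?exprn_ge0 // lerXn2r // nnegrE (le_trans _ (cP i)).
Qed.

Lemma enorm_ge0 (R : realType) n (v : 'cV[R]_n) : 0 <= enorm v.
Proof. exact: sqrtr_ge0. Qed.

Lemma enorm_sqr (R : realType) n (v : 'cV[R]_n) :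
  enorm v ^+ 2 = \sum_(i < n) v i 0 ^+ 2.
Proof. by rewrite sqr_sqrtr // sumr_ge0 // => i _; exact: sqr_ge0. Qed.

Lemma enorm_sqr_complex (R : realType) n (v : 'cV[R]_n) :
  let u := map_mx (real_complex R) v^T in
  dotmx u u = real_complex R (enorm v ^+ 2).
Proof.
rewrite /= dotmx_sum enorm_sqr rmorph_sum; apply: eq_bigr => i _.
by rewrite !mxE rmorphXn /= real_normK // complex_real.
Qed.

(** The complexification [MC] is Hermitian, hence normal. Its spectral values are real, so they are
    already eigenvalues of [M], where [cP] bounds them. *)
Lemma enorm_symmx_le (R : realType) n (M : 'M[R]_n) (c : R) (v : 'cV[R]_n) :
  0 <= c -> M^T = M -> (forall a, eigenvalue M a -> `|a| <= c) ->
  enorm (M *m v) <= c * enorm v.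
Proof.
move=> c0 Msym cP; pose MC := map_mx (real_complex R) M.
have MCh : MC \is hermsymmx.
  apply: realsym_hermsym; first last.
    by apply/mxOverP => i j; rewrite mxE complex_real.
  by apply/is_hermitianmxP; rewrite /MC scale1r map_trmx Msym map_mx_id.
have MCn := hermitian_normalmx MCh.
rewrite -ler_sqr ?nnegrE ?mulr_ge0 ?enorm_ge0 // exprMn.
rewrite -lecR -enorm_sqr_complex [leRHS]rmorphM /= -enorm_sqr_complex.
rewrite trmx_mul Msym map_mxM rmorphXn /=; apply: normalmx_dotmx_le => // i.
have /mxOverP/(_ 0 i)/complex_realP [d dE] := hermitian_spectral_diag_real MCh.
have := eigenvalue_spectral_diag i MCn; rewrite dE eigenvalue_map => /cP.
by rewrite normc_def /= expr0n addr0 sqrtr_sqr lecR.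
Qed.

Lemma enorm_gd_step_le (R : realType) n (A : 'M[R]_n) (mu alpha : R)
    (v : 'cV[R]_n) :
  A^T = A -> (forall a, eigenvalue A a -> mu <= a <= 1) ->
  0 <= mu -> 1 <= alpha <= 2 - mu ->
  enorm (v - alpha *: (A *m v)) <= (1 - mu) * enorm v.
Proof.
move=> Asym Aev mu0 /andP[a1 a2].
have -> : v - alpha *: (A *m v) = (1%:M - alpha *: A) *m v.
  by rewrite mulmxBl mul1mx scalemxAl.
apply: enorm_symmx_le => [||a /eigenvalueP[u uE u0]]; first lra.
  by rewrite linearB /= trmx1 linearZ /= Asym.
have alpha0 : alpha != 0 by rewrite gt_eqF //; lra.
(* Solving [a = 1 - alpha * l] for [l]: an eigenvector of [1 - alpha A] for [a] is one of [A] for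
   [l]. *)
pose l := (1 - a) / alpha.
have /Aev /andP[mul l1] : eigenvalue A l.
  apply/eigenvalueP; exists u => //; apply: (scalerI alpha0).
  move: uE; rewrite mulmxBr mulmx1 -scalemxAr scalerA mulrC divfK //.
  by rewrite scalerBl scale1r => <-; rewrite opprB addrC subrK.
have -> : a = 1 - alpha * l by rewrite /l mulrC divfK // opprB addrC subrK.
(* Both bounds come from [mu <= l <= alpha * l <= alpha <= 2 - mu]. *)
by rewrite ler_norml; apply/andP; split; nra.
Qed.

Lemma powR_inv_le (R : realType) (p c : R) (m : nat) :
  (0 < m)%N -> 0 <= p -> 0 <= c -> p <= c ^+ m -> p `^ m%:R^-1 <= c.
Proof.
move=> m0 p0 c0 pc.
have := @ge0_ler_powR R m%:R^-1 _ p (c ^+ m).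
rewrite !nnegrE invr_ge0 ler0n exprn_ge0 // => /(_ isT p0 isT pc).
by rewrite -powR_mulrn // -powRrM mulfV ?pnatr_eq0 -?lt0n // powRr1.
Qed.

Lemma window_rate_itv (R : realType) n (r : nat -> 'cV[R]_n) (c : R)
    (l k : nat) :
  (0 < l)%N -> (0 < k)%N -> 0 <= c -> (forall i, (i < k)%N -> r i != 0) ->
  (forall i, (0 < i <= k)%N -> enorm (r i) / enorm (r i.-1) <= c) ->
  0 <= window_rate r l k <= c.
Proof.
move=> l0 k0 c0 nz rc.
(* If [k < l], the rate telescopes to the one with window [k]; this is where nonzero residuals
   matter. *)
wlog lk : l l0 / (l <= k)%N => [hw|].
  have [lk|kl] := leqP l k; first exact: hw.
  by rewrite {1 2}/window_rate kl -window_rate_full //; apply: hw.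
have q0 i : 0 <= enorm (r i) / enorm (r i.-1).
  by rewrite divr_ge0 ?enorm_ge0.
rewrite /window_rate ltnNge lk /= powR_ge0 powR_inv_le ?prodr_ge0 //.
(* The window has exactly [l] factors, so [c ^+ l] becomes a constant product over the same range,
   compared factor by factor. *)
rewrite -[in leRHS](_ : k.+1 - (k - l).+1 = l)%N; last by rewrite subSS subKn.
rewrite -prodr_const_nat big_nat [leRHS]big_nat; apply: ler_prod => i /andP[li ik].
by rewrite q0 rc // (leq_ltn_trans _ li).
Qed.

Theorem lemma2p4 (R : realType) (n : nat) (A : 'M[R]_n) (mu L : R)
    (b x0 : 'cV[R]_n) (rho : nat -> R)
    (x r : nat -> 'cV[R]_n) (alpha : nat -> R)
    (hA : spd A)
    (hmu : smallest_eigenvalue A mu) (mu_gt0 : 0 < mu)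
    (hL : largest_eigenvalue A L) (L_le1 : L <= 1)
    (hgd : adaptive_gd A b x0 rho x r alpha)
    (hrho :
       (exists2 l : nat, (1 <= l)%N &
          forall k : nat, (1 <= k)%N -> rho k = window_rate r l k) \/
       (forall k : nat, (1 <= k)%N -> rho k = window_rate r k k)) :
  forall k : nat, (1 <= k)%N -> (forall i : nat, (i < k)%N -> r i != 0) ->
    0 <= enorm (r k) / enorm (r k.-1) <= 1 - mu.
Proof.
(* A window length [w k] depending on the iteration covers the fixed window and the full history at
   once. *)
have [w w_gt0 rhoE] : exists2 w : nat -> nat, (forall k, (0 < k)%N -> (0 < w k)%N)
    & forall k, (0 < k)%N -> rho k = window_rate r (w k) k.
  by case: hrho => [[l l0 rhoE]|rhoE]; [exists (fun=> l) | exists id].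
have [Asym _] := hA; have [muev muP] := hmu; have [_ LP] := hL.
have [_ rE alpha1 xE alphaE] := hgd.
have ev a : eigenvalue A a -> mu <= a <= 1.
  by move=> aev; rewrite muP // (le_trans (LP _ aev)).
have /andP[_ mu1] := ev _ muev.
elim/ltn_ind => -[//|k] IH _ nz /=.
have rS : r k.+1 = r k - alpha k.+1 *: (A *m r k).
  by rewrite !rE xE //= mulmxDr -scalemxAr opprD addrA -rE.
have alpha_itv : 1 <= alpha k.+1 <= 2 - mu.
  (* The first step size is the constant 1, admissible since [mu <= 1]; later ones are [1 + rho],
     controlled by the earlier ratios. *)
  case: k => [|k] in IH nz {rS} *; first by rewrite alpha1; lra.
  rewrite alphaE // rhoE //.
  have /andP[] : 0 <= window_rate r (w k.+1) k.+1 <= 1 - mu; last by lra.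
  apply: window_rate_itv => [|//||i ik|i /andP[i0 ik]]; first exact: w_gt0.
  - by rewrite subr_ge0.
  - by apply: nz; exact: ltnW.
  - suff /andP[] : 0 <= enorm (r i) / enorm (r i.-1) <= 1 - mu by [].
    by apply: IH => // j ji; apply/nz/(leq_trans ji)/ltnW.
rewrite divr_ge0 ?enorm_ge0 //= ler_pdivrMr; last first.
  by rewrite lt_def enorm_eq0 nz // enorm_ge0.
by rewrite rS; apply: enorm_gd_step_le => //; exact: ltW.
Qed.
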